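(* Let $N\ge 1$, let $\mathcal{G}$ be a closed (hence compact) subgroup of the unitary group $U(N)$, let $(e_1,\dots,e_N)$ be an orthonormal basis of $\mathbb{C}^N$, and let $\mathcal{H}:=\{H\in\mathcal{G}\mid H(e_1)=e_1\}$. Let $\mathcal{M}$ be the set of elements of $\mathcal{G}$ which are reflections with respect to a hyperplane of $\mathbb{C}^N$, and suppose that $$\{G(e_1)\mid G\in\mathcal{G}\}=\{M(e_1)\mid M\in\mathcal{M}\}.$$ Let $g:\mathcal{H}\to U(N-1)$ be the map sending $H$ to its restriction to $\mathrm{span}(e_2,\dots,e_N)$ (written as a matrix in the basis $(e_2,\dots,e_N)$). Let $G$, $G'$ and $H$ be independent random matrices, where $G$ and $G'$ have distribution $\mu_{\mathcal{G}}$ and $H$ has distribution $g(\mu_{\mathcal{H}})$. Then the following equality in law holds: $$\det(\mathrm{Id}_N-G)\overset{\text{law}}{=}\bigl(1-\langle e_1,G'(e_1)\rangle\bigr)\,\det(\mathrm{Id}_{N-1}-H).$$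
   Context: For a compact group $\mathcal{A}$, $\mu_{\mathcal{A}}$ denotes its Haar probability measure; $g(\mu_{\mathcal{H}})$ is the image (pushforward) measure of $\mu_{\mathcal{H}}$ under $g$. $\langle a,b\rangle$ is the Hermitian product on $\mathbb{C}^N$, taken linear in $b$. An element $M\in U(N)$ is called a reflection with respect to a hyperplane of $\mathbb{C}^N$ if it fixes pointwise some (complex, linear) hyperplane, i.e. $M-\mathrm{Id}_N$ has rank at most $1$; the remaining eigenvalue may be any complex number of modulus one (so the identity is allowed). Elements of $\mathcal{H}$ are unitary and fix $e_1$, so they preserve $\mathrm{span}(e_2,\dots,e_N)$. For $N=1$, a $0\times 0$ determinant equals $1$. *)

(* Defs.v *)
From HB Require Import structures.
From mathcomp Require Import all_boot all_order all_algebra.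
From mathcomp Require Import complex.
From mathcomp Require Import all_classical all_reals all_analysis.

Set Implicit Arguments.
Unset Strict Implicit.
Unset Printing Implicit Defensive.

Import Order.TTheory GRing.Theory Num.Theory.
Import numFieldNormedType.Exports.

Local Open Scope classical_set_scope.
Local Open Scope ring_scope.

(* The topology of the complex modulus on R[i]; matrices over R[i] then get
   the product topology from the library. *)
HB.instance Definition _ (R : realType) := PseudoPointedMetric.copy R[i] R[i]^o.

Notation borel T := (g_sigma_algebraType (@open T)).

Section linear_algebra.
Variable R : realType.
Local Notation C := R[i].

Definition hdot N (a b : 'cV[C]_N) : C := \sum_i (a i 0)^* * b i 0.

Definition orthonormal_basis N (e : 'I_N -> 'cV[C]_N) :=
  forall i j, hdot (e i) (e j) = (i == j)%:R.

Definition closed_unitary_subgroup N (G : set 'M[C]_N) :=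
  [/\ closed G, G `<=` [set A | A \is unitarymx], G 1%:M,
      (forall A B, G A -> G B -> G (A *m B)) &
      (forall A, G A -> G (invmx A))].

Definition stabilizer N (G : set 'M[C]_N) (v : 'cV[C]_N) : set 'M[C]_N :=
  [set A | G A /\ A *m v = v].

(* The identity, and more generally any eigenvalue off the hyperplane, is
   allowed. *)
Definition hyperplane_reflection n (M : 'M[C]_n.+1) :=
  M \is unitarymx /\
  exists2 W : {vspace 'cV[C]_n.+1}, \dim W = n &
    forall x : 'cV[C]_n.+1, x \in W -> M *m x = x.

(* In an orthonormal basis the i-th coordinate of a vector v is <e_i, v>; see
   restr_mxP below. *)
Definition restr_mx n (e : 'I_n.+1 -> 'cV[C]_n.+1) (A : 'M[C]_n.+1) : 'M[C]_n :=
  \matrix_(i, j) hdot (e (lift ord0 i)) (A *m e (lift ord0 j)).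

End linear_algebra.

Section probability.
Variable R : realType.
Local Notation C := R[i].

(* A probability measure on a closed subgroup A of U(N) is seen as a Borel
   probability measure on 'M_N giving mass 1 to A. *)
Definition haar_probability N (A : set 'M[C]_N)
    (mu : probability (borel 'M[C]_N) R) :=
  mu A = 1%E /\
  forall g, A g -> forall B : set (borel 'M[C]_N), measurable B ->
    mu [set g *m x | x in B] = mu B.

Context d (Omega : measurableType d) (P : probability Omega R).

Definition has_law d' (T : measurableType d') (X : {RV P >-> T})
    (mu : set T -> \bar R) :=
  forall B, measurable B -> distribution P X B = mu B.

Definition independent3 d1 d2 d3 (T1 : measurableType d1)
    (T2 : measurableType d2) (T3 : measurableType d3)
    (X : {RV P >-> T1}) (Y : {RV P >-> T2}) (Z : {RV P >-> T3}) :=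
  forall (A : set T1) (B : set T2) (D : set T3),
    measurable A -> measurable B -> measurable D ->
    P (X @^-1` A `&` Y @^-1` B `&` Z @^-1` D) =
    (P (X @^-1` A) * P (Y @^-1` B) * P (Z @^-1` D))%E.

Definition eq_in_law d' (T : measurableType d') (X Y : Omega -> T) :=
  forall B : set T, measurable B -> pushforward P X B = pushforward P Y B.

End probability.

Section restriction.
Variables (R : realType) (n : nat) (e : 'I_n.+1 -> 'cV[R[i]]_n.+1).
Hypothesis e_on : orthonormal_basis e.
Local Notation "A ^t*" := (map_mx Num.conj A^T).
Local Notation E := (\matrix_(i, j) e j i 0).

Lemma hdotE N (a b : 'cV[R[i]]_N) : hdot a b = (a ^t* *m b) 0 0.
Proof. by rewrite mxE; apply: eq_bigr => i _; rewrite !mxE. Qed.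

Lemma hdot_unitary N (A : 'M[R[i]]_N) (a b : 'cV[R[i]]_N) :
  A \is unitarymx -> hdot (A *m a) (A *m b) = hdot a b.
Proof.
move=> /unitarymxP/mulmx1C AA.
by rewrite !hdotE trmx_mul map_mxM mulmxA -(mulmxA _ _ A) AA mulmx1.
Qed.

Lemma onb_mulVmx : E ^t* *m E = 1%:M.
Proof.
apply/matrixP => i j; rewrite !mxE -e_on.
by apply: eq_bigr => k _; rewrite !mxE.
Qed.

Lemma onb_expand (v : 'cV[R[i]]_n.+1) : v = \sum_i hdot (e i) v *: e i.
Proof.
rewrite -[LHS]mul1mx -(mulmx1C onb_mulVmx) -mulmxA.
apply/matrixP => i j; rewrite ord1 !mxE summxE; apply: eq_bigr => k _.
rewrite !mxE mulrC; congr (_ * _).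
by apply: eq_bigr => l _; rewrite !mxE.
Qed.

Lemma onb_parseval (u v : 'cV[R[i]]_n.+1) :
  hdot u v = \sum_i (hdot (e i) u)^* * hdot (e i) v.
Proof.
rewrite {1}[v]onb_expand hdotE mulmx_sumr summxE; apply: eq_bigr => i _.
rewrite -scalemxAr mxE -hdotE mulrC; congr (_ * _).
rewrite rmorph_sum; apply: eq_bigr => k _.
by rewrite rmorphM /= conjCK mulrC.
Qed.

Variable A : 'M[R[i]]_n.+1.
Hypotheses (A_unitary : A \is unitarymx) (Ae : A *m e ord0 = e ord0).

Lemma hdot_stabilizer j : hdot (e ord0) (A *m e (lift ord0 j)) = 0.
Proof. by rewrite -{1}Ae hdot_unitary// e_on. Qed.

Lemma restr_mxP j :
  A *m e (lift ord0 j) = \sum_i restr_mx e A i j *: e (lift ord0 i).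
Proof.
rewrite [LHS]onb_expand big_ord_recl hdot_stabilizer scale0r add0r.
by apply: eq_bigr => i _; rewrite mxE.
Qed.

Lemma restr_mx_unitary : restr_mx e A \is unitarymx.
Proof.
rewrite -trmxC_unitary; apply/unitarymxP; apply/matrixP => i j.
rewrite !mxE -(inj_eq (@lift_inj _ ord0)) -e_on -(hdot_unitary _ _ A_unitary).
rewrite onb_parseval big_ord_recl !hdot_stabilizer mulr0 add0r.
by apply: eq_bigr => k _; rewrite !mxE conjCK.
Qed.

End restriction.

(* Main.v *)
(* A reflection M has the form 1 + u w with u a column and w a row, so that
   det (1 - M h) = (1 - <e_1, M e_1>) det (1 - h') for every unitary h fixing
   e_1, where h' is the restriction of h.  By right invariance of Haar measure,
   det (1 - g) has the law of det (1 - g h) with g, h independent and Haar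
   distributed on G and on the stabilizer of e_1.  For fixed g, choose a
   reflection M in G with M e_1 = g e_1: then g = M h0 with h0 in the
   stabilizer, and left invariance lets h absorb h0.  Since M is chosen after
   fixing g, no measurable selection is needed. *)

Require Import Defs.
From HB Require Import structures.
From mathcomp Require Import all_boot all_order all_algebra.
From mathcomp Require Import complex.
From mathcomp Require Import all_classical all_reals all_analysis.
From mathcomp Require Import measurable_realfun lra.

Set Implicit Arguments.
Unset Strict Implicit.
Unset Printing Implicit Defensive.

Import Order.TTheory GRing.Theory Num.Theory.
Import numFieldNormedType.Exports.

Local Open Scope classical_set_scope.
Local Open Scope ring_scope.

(** * Rank-one perturbations and the determinant of a reflection times a stabilizing unitary *)

Lemma fixed_hyperplane_rank1 (K : fieldType) (n : nat) (A : 'M[K]_n.+1)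
    (W : {vspace 'cV[K]_n.+1}) :
  \dim W = n -> (forall x, x \in W -> A *m x = x) ->
  exists (u : 'cV[K]_n.+1) (v : 'rV[K]_n.+1), A = 1%:M + u *m v.
Proof.
move=> dimW fixW.
pose f : 'Hom('cV[K]_n.+1, 'cV[K]_n.+1) := linfun (mulmx (A - 1%:M)).
have Wker : (W <= lker f)%VS.
  apply/subvP => x xW; rewrite memv_ker lfunE /= mulmxBl mul1mx fixW//.
  by rewrite subrr.
(* Rank-nullity: the kernel of [A - 1] contains [W], of dimension [n] in a space of dimension
   [n.+1], so the image lies in a line, spanned by the [u] found next ([u = 0] when [A = 1]). *)
have dimf : (\dim (limg f) <= 1)%N.
  have := limg_ker_dim f fullv; rewrite capfv dimvf /dim /= muln1 => dimE.
  by have := dimvS Wker; rewrite dimW -(leq_add2r (\dim (limg f))) dimE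
    -[leqRHS]addn1 leq_add2l.
have [u limgE] : exists u, (limg f <= <[u]>)%VS.
  have [->|imn0] := eqVneq (limg f) 0%VS; first by exists 0; exact: sub0v.
  exists (vpick (limg f)).
  rewrite (eqP (_ : <[vpick (limg f)]> == limg f))%VS//.
  rewrite eqEdim -memvE memv_pick dim_vline vpick0 imn0 /=.
  exact: dimf.
(* The columns of [A - 1] are the images of the standard basis vectors, hence multiples of [u];
   their coefficients form the row [v]. *)
have coef j : exists c, col j (A - 1%:M) = c *: u.
  have /vlineP[c uE] : f (delta_mx j 0) \in <[u]>%VS.
    by apply: (subvP limgE); rewrite memv_img// memvf.
  by exists c; rewrite -uE lfunE /= colE.
have [v vP] := choice coef.
exists u, (\row_j v j); apply/matrixP => i j.
have /matrixP/(_ i 0) := vP j; rewrite !mxE big_ord1 !mxE mulrC => <-.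
by rewrite addrC subrK.
Qed.

(** The first row and column come from the rank-one term alone, so the matrix factors as block lower
    triangular times block upper triangular. No inverse of [B] is taken: [B] will be [1 - h'], which
    may be singular. *)
Lemma det_block_rank1 (K : comNzRingType) (n : nat) (a : K) (b : 'rV[K]_n)
    (u : 'cV[K]_(1 + n)) (B : 'M[K]_n) :
  \det (block_mx (0 : 'M[_]_1) 0 0 B - u *m row_mx (a%:M : 'M[_]_1) b) =
  - (usubmx u 0 0 * a) * \det B.
Proof.
rewrite -[u in LHS]vsubmxK mul_col_row opp_block_mx add_block_mx !sub0r.
have -> : block_mx (- (usubmx u *m a%:M)) (- (usubmx u *m b))
      (- (dsubmx u *m a%:M)) (B - dsubmx u *m b) =
    block_mx (- usubmx u) 0 (- dsubmx u) B *m block_mx a%:M b 0 1%:M.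
  by rewrite mulmx_block !mulNmx !mulmx0 !mulmx1 !addr0 [- _ + B]addrC.
rewrite det_mulmx det_lblock det_ublock det1 mulr1 !det_mx11 !mxE eqxx.
by rewrite -!mulrA -!mulNr -[RHS]mulrA; congr (_ * _); rewrite mulrC.
Qed.

Section reflection.
Variables (R : realType) (n : nat) (e : 'I_n.+1 -> 'cV[R[i]]_n.+1).
Hypothesis e_on : orthonormal_basis e.
Local Notation "A ^t*" := (map_mx Num.conj A^T) : ring_scope.
Local Notation E := (\matrix_(i, j) e j i 0).

Lemma onb_conj_mx (A : 'M[R[i]]_n.+1) :
  E ^t* *m A *m E = \matrix_(i, j) hdot (e i) (A *m e j).
Proof.
apply/matrixP => i j; rewrite -mulmxA !mxE; apply: eq_bigr => k _.
rewrite !mxE; congr (_ * _); apply: eq_bigr => l _; by rewrite !mxE.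
Qed.

(** Lower left block: [h] fixes [e ord0], which is orthogonal to the other basis vectors. Upper
    right block: [h] also preserves the Hermitian product, hence the orthogonal complement of
    [e ord0]. *)
Lemma onb_conj_stabilizer (h : 'M[R[i]]_n.+1) :
  h \is unitarymx -> h *m e ord0 = e ord0 ->
  (E ^t* *m h *m E : 'M[_]_(1 + n)) =
  block_mx (1%:M : 'M[_]_1) 0 0 (restr_mx e h).
Proof.
move=> hU he; rewrite onb_conj_mx.
apply: etrans (esym (@submxK _ 1 n 1 n _)) _; congr block_mx;
  apply/matrixP => i j; rewrite !mxE ?ord1.
- by rewrite (_ : lshift n 0 = ord0) ?he ?e_on; [|exact/val_inj].
- rewrite (_ : lshift n 0 = ord0) ?rshift1 ?hdot_stabilizer//; exact/val_inj.
- rewrite (_ : lshift n 0 = ord0) ?rshift1 ?he ?e_on//; exact/val_inj.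
- by rewrite !rshift1.
Qed.

(** Write [M = 1 + u v], so that [1 - M h = (1 - h) - u (v h)]. In the basis [e], the first row and
    column of [1 - h] vanish, and [v h] has the same first entry as [v] because [h] fixes [e ord0].
    Then [det_block_rank1] applies, and its scalar is minus the product of the first coordinates of
    [u] and [v], which is [1 - <e_1, M e_1>]. *)
Lemma det_reflection_stabilizer (M h : 'M[R[i]]_n.+1) :
  hyperplane_reflection M -> h \is unitarymx -> h *m e ord0 = e ord0 ->
  \det (1%:M - M *m h) =
  (1 - hdot (e ord0) (M *m e ord0)) * \det (1%:M - restr_mx e h).
Proof.
move=> [_ [W dimW fixW]] hU he.
have [u [v ->]] := fixed_hyperplane_rank1 dimW fixW.
have EE := onb_mulVmx e_on; have EE' := mulmx1C EE.
have detE : \det (E ^t*) * \det E = 1 by rewrite -det_mulmx EE det1.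
pose u' : 'cV_(1 + n) := E ^t* *m u.
pose v' : 'rV_(1 + n) := v *m E.
have sub1_block (K : 'M[R[i]]_n) :
    1%:M - block_mx (1%:M : 'M[_]_1) 0 0 K = block_mx 0 0 0 (1%:M - K).
  by rewrite scalar_mx_block opp_block_mx add_block_mx !subrr.
have row_block (y : 'rV[R[i]]_(1 + n)) (K : 'M[R[i]]_n) :
    y *m block_mx (1%:M : 'M[_]_1) 0 0 K = row_mx (y 0 0)%:M (rsubmx y *m K).
  rewrite -[y in LHS]hsubmxK mul_row_block !mulmx0 mulmx1 addr0 add0r.
  congr row_mx; apply/matrixP => i j; rewrite !mxE !ord1 eqxx mulr1n.
  by congr (y _ _); exact/val_inj.
have conjE : E ^t* *m (1%:M - (1%:M + u *m v) *m h) *m E =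
    block_mx (0 : 'M[_]_1) 0 0 (1%:M - restr_mx e h) -
      u' *m row_mx (v' 0 0)%:M (rsubmx v' *m restr_mx e h).
  rewrite mulmxDl mul1mx opprD addrA mulmxBr mulmxBl; congr (_ - _).
    by rewrite mulmxBr mulmxBl mulmx1 EE onb_conj_stabilizer//.
  (* The product of [E] and its adjoint, equal to 1, is inserted between [v] and [h]. *)
  have -> : E ^t* *m (u *m v *m h) *m E = u' *m (v' *m (E ^t* *m h *m E)).
    by rewrite /u' /v' !mulmxA -(mulmxA _ E (E ^t*)) EE' mulmx1.
  by rewrite onb_conj_stabilizer// row_block.
have -> : \det (1%:M - (1%:M + u *m v) *m h) =
    \det (E ^t* *m (1%:M - (1%:M + u *m v) *m h) *m E).
  by rewrite !det_mulmx mulrAC detE mul1r.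
rewrite conjE det_block_rank1; congr (_ * _).
have hdotD (a b c : 'cV[R[i]]_n.+1) : hdot a (b + c) = hdot a b + hdot a c.
  by rewrite !hdotE mulmxDr mxE.
rewrite mulmxDl mul1mx hdotD e_on eqxx opprD addrA subrr sub0r.
congr (- _); rewrite hdotE -(mulmxA u) (mulmxA _ u) [RHS]mxE big_ord1.
congr (_ * _).
  rewrite !mxE; apply: eq_bigr => k _; rewrite !mxE; congr ((e _ _ _)^* * _).
  exact/val_inj.
by rewrite /v' !mxE; apply: eq_bigr => k _; rewrite !mxE.
Qed.

End reflection.

(** * Measurability of complex and matrix valued functions, by components *)

Section complex_measurable.
Context (R : realType) d (Y : measurableType d).
Local Notation C := R[i].

(** Passing to real and imaginary parts reduces closure under ring operations to the known facts on
    real functions; [measurable_fun_borelC] returns to the Borel sets of [R[i]]. *)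
Definition cmeasurable (f : Y -> C) :=
  measurable_fun setT (fun y => complex.Re (f y) : R) /\
  measurable_fun setT (fun y => complex.Im (f y) : R).

Lemma cmeasurable_cst c : cmeasurable (cst c).
Proof. by split; exact: measurable_cst. Qed.

Lemma cmeasurableN f : cmeasurable f -> cmeasurable (fun y => - f y).
Proof.
move=> [fR fI]; split.
  rewrite (_ : (fun y => _) = \- (fun y => complex.Re (f y) : R)).
    exact: measurable_funN.
  by apply/funext => y /=; case: (f y).
rewrite (_ : (fun y => _) = \- (fun y => complex.Im (f y) : R)).
  exact: measurable_funN.
by apply/funext => y /=; case: (f y).
Qed.

Lemma cmeasurable_conj f : cmeasurable f -> cmeasurable (fun y => (f y)^*).
Proof.
move=> [fR fI]; split.
  by rewrite (_ : (fun y => _) = (fun y => complex.Re (f y) : R))//;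
    apply/funext => y /=; case: (f y).
rewrite (_ : (fun y => _) = \- (fun y => complex.Im (f y) : R)).
  exact: measurable_funN.
by apply/funext => y /=; case: (f y).
Qed.

Lemma cmeasurableD f g :
  cmeasurable f -> cmeasurable g -> cmeasurable (fun y => f y + g y).
Proof.
move=> [fR fI] [gR gI]; split.
  rewrite (_ : (fun y => _) =
    (fun y => complex.Re (f y)) \+ (fun y => complex.Re (g y))).
    exact: measurable_funD.
  by apply/funext => y /=; case: (f y); case: (g y).
rewrite (_ : (fun y => _) =
  (fun y => complex.Im (f y)) \+ (fun y => complex.Im (g y))).
  exact: measurable_funD.
by apply/funext => y /=; case: (f y); case: (g y).
Qed.

Lemma cmeasurableM f g :
  cmeasurable f -> cmeasurable g -> cmeasurable (fun y => f y * g y).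
Proof.
move=> [fR fI] [gR gI]; split.
  rewrite (_ : (fun y => _) =
    ((fun y => complex.Re (f y)) \* (fun y => complex.Re (g y))) \-
    ((fun y => complex.Im (f y)) \* (fun y => complex.Im (g y)))).
    by apply: measurable_funB; exact: measurable_funM.
  by apply/funext => y /=; case: (f y); case: (g y).
rewrite (_ : (fun y => _) =
  ((fun y => complex.Re (f y)) \* (fun y => complex.Im (g y))) \+
  ((fun y => complex.Im (f y)) \* (fun y => complex.Re (g y)))).
  by apply: measurable_funD; exact: measurable_funM.
by apply/funext => y /=; case: (f y); case: (g y).
Qed.

Lemma cmeasurable_sum I (s : seq I) (h : I -> Y -> C) :
  (forall i, cmeasurable (h i)) -> cmeasurable (fun y => \sum_(i <- s) h i y).
Proof.
move=> mh; elim: s => [|i s IH].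
  by under eq_fun do rewrite big_nil; exact: cmeasurable_cst.
by under eq_fun do rewrite big_cons; exact: cmeasurableD.
Qed.

Lemma cmeasurable_prod I (s : seq I) (h : I -> Y -> C) :
  (forall i, cmeasurable (h i)) -> cmeasurable (fun y => \prod_(i <- s) h i y).
Proof.
move=> mh; elim: s => [|i s IH].
  by under eq_fun do rewrite big_nil; exact: cmeasurable_cst.
by under eq_fun do rewrite big_cons; exact: cmeasurableM.
Qed.

(** Equivalent to Borel measurability, by [mxmeasurable_fun] and [measurable_fun_mx]. *)
Definition mxmeasurable m n (f : Y -> 'M[C]_(m, n)) :=
  forall i j, cmeasurable (fun y => f y i j).

Lemma mxmeasurable_cst m n (A : 'M[C]_(m, n)) : mxmeasurable (cst A).
Proof. by move=> i j; exact: cmeasurable_cst. Qed.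

Lemma mxmeasurableB m n (f g : Y -> 'M[C]_(m, n)) :
  mxmeasurable f -> mxmeasurable g -> mxmeasurable (fun y => f y - g y).
Proof.
move=> mf mg i j; under eq_fun do rewrite !mxE.
by apply: cmeasurableD => //; exact: cmeasurableN.
Qed.

Lemma mxmeasurable_adj m n (f : Y -> 'M[C]_(m, n)) :
  mxmeasurable f -> mxmeasurable (fun y => map_mx Num.conj (f y)^T).
Proof.
by move=> mf i j; under eq_fun do rewrite !mxE; exact: cmeasurable_conj.
Qed.

Lemma mxmeasurableM m n p (f : Y -> 'M[C]_(m, n)) (g : Y -> 'M[C]_(n, p)) :
  mxmeasurable f -> mxmeasurable g -> mxmeasurable (fun y => f y *m g y).
Proof.
move=> mf mg i j; under eq_fun do rewrite !mxE.
by apply: cmeasurable_sum => k; exact: cmeasurableM.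
Qed.

(** Leibniz expansion over permutations. *)
Lemma cmeasurable_det n (f : Y -> 'M[C]_n) :
  mxmeasurable f -> cmeasurable (fun y => \det (f y)).
Proof.
move=> mf; apply: cmeasurable_sum => s; apply: cmeasurableM.
  exact: cmeasurable_cst.
by apply: cmeasurable_prod => k.
Qed.

Lemma cmeasurable_hdot n (f g : Y -> 'cV[C]_n) :
  mxmeasurable f -> mxmeasurable g -> cmeasurable (fun y => hdot (f y) (g y)).
Proof.
move=> mf mg; apply: cmeasurable_sum => k.
by apply: cmeasurableM => //; exact: cmeasurable_conj.
Qed.

End complex_measurable.

(** * Componentwise measurability against the Borel sigma-algebra *)

Section borel_measurable.
Context (R : realType).
Local Notation C := R[i].

Lemma Im_le_normc (z : C) : `|complex.Im z|%:C%C <= `|z|.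
Proof.
by rewrite normc_def lecR -sqrtr_sqr ler_wsqrtr// lerDr sqr_ge0.
Qed.

Lemma normc_le_ReIm (z : C) :
  `|z| <= (`|complex.Re z| + `|complex.Im z|)%:C%C.
Proof.
rewrite normc_def lecR -[leRHS]ger0_norm ?addr_ge0// -sqrtr_sqr ler_wsqrtr//.
rewrite sqrrD !real_normK ?num_real// addrAC lerDl.
by rewrite mulrn_wge0// mulr_ge0.
Qed.

Lemma cmeasurable_comp d d' (Y : measurableType d) (Z : measurableType d')
    (f : Z -> C) (g : Y -> Z) :
  cmeasurable f -> measurable_fun setT g -> cmeasurable (f \o g).
Proof.
move=> [fR fI] mg; split.
  exact: (measurableT_comp fR).
exact: (measurableT_comp fI).
Qed.

Lemma open_borel_measurable (T : ptopologicalType) (U : set T) :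
  open U -> measurable (U : set (borel T)).
Proof. by move=> oU; exact: sub_sigma_algebra. Qed.

(** Real and imaginary parts are additive and bounded by the modulus, hence 1-Lipschitz, so the
    preimage of a ray []a, +oo[] is open: around [A] it contains the ball of radius
    [h (A i j) - a]. *)
Lemma cmeasurable_entry m n (i : 'I_m) (j : 'I_n) :
  cmeasurable (fun A : borel 'M[C]_(m, n) => A i j).
Proof.
have mh (h : C -> R) : {morph h : x y / x - y} ->
    (forall z, `|h z|%:C%C <= `|z|) ->
    measurable_fun setT (fun A : borel 'M[C]_(m, n) => h (A i j)).
  move=> hB h_le; apply: (measurability _ (RGenOInfty.measurableE R)) => //.
  move=> /= _ [_ [a ->] <-]; rewrite setTI; apply: open_borel_measurable.
  rewrite openE => A /=; rewrite in_itv /= andbT => aA.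
  apply/nbhs_ballP; exists (h (A i j) - a)%:C%C.
    by rewrite /= ltcR subr_gt0.
  move=> B [_ /(_ i j)]; rewrite /ball /= => AB; rewrite in_itv /= andbT.
  have := le_lt_trans (h_le _) AB.
  rewrite ltcR hB => /(le_lt_trans (ler_norm _)).
  by rewrite ltrD2l ltrN2.
split; apply: mh.
- by case=> [? ?] [? ?].
- exact: normc_ge_Re.
- by case=> [? ?] [? ?].
- exact: Im_le_normc.
Qed.

Lemma mxmeasurable_fun d (Y : measurableType d) m n (f : Y -> 'M[C]_(m, n)) :
  measurable_fun setT (f : Y -> borel 'M[C]_(m, n)) -> mxmeasurable f.
Proof.
by move=> mf i j; exact: (cmeasurable_comp (cmeasurable_entry i j) mf).
Qed.

Lemma mxmeasurable_id m n : mxmeasurable (fun A : borel 'M[C]_(m, n) => A).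
Proof. exact: (mxmeasurable_fun (@measurable_id _ (borel 'M[C]_(m, n)) _)). Qed.

(* Boxes with rational centres and sizes form a countable base of the topology
   of 'M[C]_(m, n). *)
Lemma measurable_fun_mx d (Y : measurableType d) m n (f : Y -> 'M[C]_(m, n)) :
  mxmeasurable f -> measurable_fun setT (f : Y -> borel 'M[C]_(m, n)).
Proof.
move=> mf.
refine (@measurability _ _ Y (borel 'M[C]_(m, n)) setT f
  (@open 'M[C]_(m, n)) erefl _); move=> _ [U oU <-].
  rewrite setTI.
pose box (q : 'M[rat * rat]_(m, n) * rat) : set 'M[C]_(m, n) :=
  [set A | forall p : 'I_m * 'I_n,
    `|complex.Re (A p.1 p.2) - ratr (q.1 p.1 p.2).1| < ratr q.2 :> R /\
    `|complex.Im (A p.1 p.2) - ratr (q.1 p.1 p.2).2| < ratr q.2 :> R].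
have mbox q : measurable (f @^-1` box q).
  rewrite (_ : _ @^-1` _ = \bigcap_(p : 'I_m * 'I_n)
    ([set y | `|complex.Re (f y p.1 p.2) - ratr (q.1 p.1 p.2).1| < ratr q.2] `&`
     [set y | `|complex.Im (f y p.1 p.2) - ratr (q.1 p.1 p.2).2| < ratr q.2])).
    apply: fin_bigcap_measurable => // p _.
    have mlt (g : Y -> R) (a b : R) : measurable_fun setT g ->
        measurable [set y | `|g y - a| < b].
      move=> mg; rewrite (_ : [set y | _] = g @^-1` `]a - b, a + b[%classic).
        by rewrite -[X in measurable X]setTI; apply: mg => //;
          exact: measurable_itv.
      by apply/seteqP; split => y /=; rewrite in_itv /= ltr_distl.
    by case: (mf p.1 p.2) => fR fI; apply: measurableI; exact: mlt.
  by apply/seteqP; split => [y fy p _|y fy p]; have := fy p => //; apply.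
(* [U] is the union of the rational boxes that it contains. Boxes not inside [U] are replaced by the
   empty set, so that the union runs over a whole countable type. *)
rewrite (_ : _ @^-1` _ =
    \bigcup_q (if `[< box q `<=` U >] then f @^-1` box q else set0)).
  by apply: countable_bigcupT_measurable => // q; case: ifP.
apply/seteqP; split => [y Ufy|y [q _]]; last first.
  by case: ifPn => // /asboolP qU; exact: qU.
have : nbhs (f y) U by move: oU; rewrite openE; exact.
move=> /nbhs_ballP[[e e'] /= e0 eU].
(* The radius of a ball is an element of [R[i]]; being positive, it is real. *)
have e'0 : e' = 0 by move: e0; rewrite ltcE /= => /andP[/eqP].
subst e'; move: e0; rewrite ltcR => e0.
(* Two points of a box of half-width [r] differ by less than [2 r] in each real coordinate, so each
   entry moves by less than [4 r < e] in modulus. *)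
have [r /andP[r0 re]] : exists r : rat, 0 < (ratr r : R) < e / 4.
  have /rat_in_itvoo[r] : 0 < e / 4 by rewrite divr_gt0.
  by rewrite in_itv /= => ?; exists r.
have approx (x : R) : exists q : rat, `|x - ratr q| < ratr r.
  have /rat_in_itvoo[q] : x - ratr r < x + ratr r by rewrite ltrD2l gtrN.
  by rewrite in_itv /= -ltr_distl distrC => ?; exists q.
have [Q QP] := choice approx.
pose q :=
  (\matrix_(i, j) (Q (complex.Re (f y i j)), Q (complex.Im (f y i j))), r).
exists q => //; rewrite asboolT.
  by move=> p /=; rewrite mxE /=; split; exact: QP.
move=> B Bq; apply: eU; split; first by rewrite ltcR.
move=> i j; rewrite /ball /=; apply: le_lt_trans (normc_le_ReIm _) _.
rewrite ltcR; have [] := Bq (i, j); rewrite /= mxE /=.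
have := QP (complex.Re (f y i j)); have := QP (complex.Im (f y i j)).
case: (f y i j) => a b; case: (B i j) => a' b' /=.
move: (Q a) (Q b) => qa qb.
rewrite !ltr_norml => /andP[b1 b2] /andP[a1 a2] [/andP[a'1 a'2] /andP[b'1 b'2]].
have na : `|a - a'| < 2 * ratr r by rewrite ltr_norml; apply/andP; split; lra.
have nb : `|b - b'| < 2 * ratr r by rewrite ltr_norml; apply/andP; split; lra.
lra.
Qed.

(** Seen as a 1 by 1 matrix, [f] falls under [measurable_fun_mx]; the coordinate map back to [R[i]]
    is continuous. *)
Lemma measurable_fun_borelC d (Y : measurableType d) (f : Y -> C) :
  cmeasurable f -> measurable_fun setT (f : Y -> borel C).
Proof.
move=> mf.
have mf1 : measurable_fun setT (fun y => (f y)%:M : borel 'M[C]_1).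
  apply: measurable_fun_mx => i j.
  by under eq_fun do rewrite !ord1 mxE eqxx mulr1n.
rewrite (_ : f =
    (fun A : borel 'M[C]_1 => A 0 0 : borel C) \o (fun y => (f y)%:M)).
  apply: measurableT_comp mf1.
  refine (@measurability _ _ (borel 'M[C]_1) (borel C) setT _
    (@open C) erefl _).
  move=> _ [U oU <-].
  rewrite setTI; apply: open_borel_measurable.
  have /continuousP := @coord_continuous C 1 1 0 0; exact.
by apply/funext => y /=; rewrite mxE eqxx.
Qed.

Lemma measurable_mx_eq d (Y : measurableType d) m n (f g : Y -> 'M[C]_(m, n)) :
  mxmeasurable f -> mxmeasurable g -> measurable [set y | f y = g y].
Proof.
move=> mf mg; have mfg := mxmeasurableB mf mg.
rewrite (_ : [set y | _] = \bigcap_(p : 'I_m * 'I_n)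
  ([set y | complex.Re ((f y - g y) p.1 p.2) = 0] `&`
   [set y | complex.Im ((f y - g y) p.1 p.2) = 0])).
  have m0 (h : Y -> R) : measurable_fun setT h -> measurable [set y | h y = 0].
    by move=> mh; rewrite -[X in measurable X]setTI; exact: (mh _ [set 0]).
  apply: fin_bigcap_measurable => // p _; have [mR mI] := mfg p.1 p.2.
  by apply: measurableI; exact: m0.
apply/seteqP; split => [y /= fgy p _ /=|y /= fgy].
  by rewrite fgy subrr mxE.
apply/eqP; rewrite -subr_eq0; apply/eqP/matrixP => i j; rewrite [RHS]mxE.
have /= [] := fgy (i, j) I; by case: ((f y - g y) i j) => a b /= -> ->.
Qed.

End borel_measurable.

(** * Product measures computed from sections over a set of full measure *)

Lemma integral_full_set d (T1 : measurableType d) (R : realType)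
    (mu : probability T1 R) (S : set T1) (f g : T1 -> \bar R) :
  measurable S -> mu S = 1%E ->
  measurable_fun setT f -> measurable_fun setT g ->
  (forall x, S x -> f x = g x) -> (\int[mu]_x f x = \int[mu]_x g x)%E.
Proof.
move=> mS muS mf mg fg; apply: ae_eq_integral => //.
exists (~` S); split; first exact: measurableC.
  by have := probability_setC mu mS; rewrite muS subee.
by move=> x /= nfg Sx; apply: nfg => _; exact: fg.
Qed.

Section product_sections.
Local Open Scope ereal_scope.
Context d1 d2 (T1 : measurableType d1) (T2 : measurableType d2) (R : realType).

(** The product [\x] is defined by x-sections; the iterated integral in the other order agrees with
    it on rectangles, hence everywhere. *)
Lemma product_measure_ysection (mu : probability T1 R) (nu : probability T2 R)
    (A : set (T1 * T2)) : measurable A ->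
  (mu \x nu) A = \int[nu]_y mu (ysection A y).
Proof.
move=> mA; rewrite -[RHS]/((mu \x^ nu) A).
by apply: product_measure_unique => // ? ? ? ?; rewrite /= product_measure2E.
Qed.

(** The set [S] will be a group carrying its Haar measure: invariance controls the sections at
    points of the group only, while the measures live on all matrices. *)
Lemma product_measure_xsection_cst (mu : probability T1 R)
    (nu : probability T2 R) (A : set (T1 * T2)) (S : set T1) (c : \bar R) :
  measurable A -> measurable S -> mu S = 1 ->
  (forall x, S x -> nu (xsection A x) = c) -> (mu \x nu) A = c.
Proof.
move=> mA mS muS Ac; rewrite /product_measure1.
rewrite (@integral_full_set _ T1 R mu S _ (cst c))//.
- rewrite integral_cst// -[RHS]mule1; congr (_ * _); exact: probability_setT.
- exact: measurable_fun_xsection.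
Qed.

Lemma product_measure_ysection_cst (mu : probability T1 R)
    (nu : probability T2 R) (A : set (T1 * T2)) (S : set T2) (c : \bar R) :
  measurable A -> measurable S -> nu S = 1 ->
  (forall y, S y -> mu (ysection A y) = c) -> (mu \x nu) A = c.
Proof.
move=> mA mS nuS Ac; rewrite product_measure_ysection//.
rewrite (@integral_full_set _ T2 R nu S _ (cst c))//.
- rewrite integral_cst// -[RHS]mule1; congr (_ * _); exact: probability_setT.
- exact: measurable_fun_ysection.
Qed.

End product_sections.

Section product_sections_eq.
Local Open Scope ereal_scope.
Context d1 d2 d3 (T1 : measurableType d1) (T2 : measurableType d2)
  (T3 : measurableType d3) (R : realType).

(** Allows conditioning on a common first factor while the second factors live on different spaces,
    here matrices of sizes [n.+1] and [n]. *)
Lemma eq_product_measure_xsection (mu : probability T1 R) (S : set T1)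
    (nu : probability T2 R) (A : set (T1 * T2))
    (nu' : probability T3 R) (A' : set (T1 * T3)) :
  measurable A -> measurable A' -> measurable S -> mu S = 1 ->
  (forall x, S x -> nu (xsection A x) = nu' (xsection A' x)) ->
  (mu \x nu) A = (mu \x nu') A'.
Proof.
move=> mA mA' mS muS AA'; apply: (@integral_full_set _ T1 R mu S) => //.
- exact: measurable_fun_xsection.
- exact: measurable_fun_xsection.
Qed.

End product_sections_eq.

(** * Haar measure: left translates, inversion, right translates *)

Section haar.
Context (R : realType) (N : nat) (G : set 'M[R[i]]_N).
Variable mu : probability (borel 'M[R[i]]_N) R.
Local Notation "A ^t*" := (map_mx Num.conj A^T) : ring_scope.
Local Notation M := (borel 'M[R[i]]_N).
Hypothesis mG : measurable (G : set M).
Hypothesis GU : forall A, G A -> A \is unitarymx.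
Hypothesis GV : forall A, G A -> G (A ^t*).
Hypothesis haar_mu : haar_probability G mu.

Lemma adjK (A : 'M[R[i]]_N) : (A ^t*) ^t* = A.
Proof. by apply/matrixP => i j; rewrite !mxE conjCK. Qed.

(** The preimage under left multiplication by [g] is the image under left multiplication by its
    adjoint. Sections of product sets arise as preimages. *)
Lemma haar_preimage_mull (g : 'M[R[i]]_N) (B : set M) : G g -> measurable B ->
  mu [set x | B (g *m x)] = mu B.
Proof.
move=> Gg mB; rewrite -(haar_mu.2 _ (GV Gg) _ mB); congr (mu _).
have /unitarymxP gg := GU Gg; have gg' := mulmx1C gg.
apply/seteqP; split => [x /= Bx|_ [x Bx <-] /=].
  by exists (g *m x) => //; rewrite mulmxA gg' mul1mx.
by rewrite mulmxA gg mul1mx.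
Qed.

Lemma adj_preimage_measurable (B : set M) :
  measurable B -> measurable ([set x | B (x ^t*)] : set M).
Proof.
move=> mB; rewrite -[X in measurable X]setTI.
by apply: (measurable_fun_mx (mxmeasurable_adj (@mxmeasurable_id R N N))).
Qed.

(* Tonelli on [set (x, y) | x^* y \in B], whose sections are left translates of
   B and of the inverse of B. *)
Lemma haar_adj (B : set M) : measurable B -> mu [set x | B (x ^t*)] = mu B.
Proof.
move=> mB.
have mBV := adj_preimage_measurable mB.
pose A : set (M * M) := [set z | B (z.1 ^t* *m z.2)].
have mA : measurable A.
  have mf : measurable_fun setT (fun z : M * M => (z.1 ^t* *m z.2) : M).
    apply/measurable_fun_mx/mxmeasurableM.
      by apply: mxmeasurable_adj; exact: (mxmeasurable_fun measurable_fst).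
    exact: (mxmeasurable_fun measurable_snd).
  by rewrite -[X in measurable X]setTI; exact: mf.
transitivity ((mu \x mu)%E A).
  apply/esym/(product_measure_ysection_cst mA mG haar_mu.1) => y Gy.
  rewrite -(haar_preimage_mull (GV Gy) mBV); congr (mu _).
  apply/seteqP; split => x; rewrite /A /ysection /= in_setE /=;
    by rewrite trmx_mul map_mxM adjK.
apply: (product_measure_xsection_cst mA mG haar_mu.1) => x Gx.
rewrite -[RHS](haar_preimage_mull (GV Gx) mB); congr (mu _).
by apply/seteqP; split => y; rewrite /A /xsection /= in_setE.
Qed.

(** The adjoint map preserves [mu] by [haar_adj] and turns right multiplication by [g] into left
    multiplication by the adjoint of [g]. *)
Lemma haar_preimage_mulr (g : 'M[R[i]]_N) (B : set M) : G g -> measurable B ->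
  mu [set x | B (x *m g)] = mu B.
Proof.
move=> Gg mB.
have mBV := adj_preimage_measurable mB.
have mgB : measurable ([set x | B (x *m g)] : set M).
  have mg : measurable_fun setT (fun x : M => (x *m g) : M).
    apply/measurable_fun_mx/mxmeasurableM; last exact: mxmeasurable_cst.
    exact: mxmeasurable_id.
  by rewrite -[X in measurable X]setTI; exact: mg.
rewrite -(haar_adj mgB).
rewrite -[RHS]haar_adj// -[RHS](haar_preimage_mull (GV Gg) mBV); congr (mu _).
by apply/seteqP; split => x /=; rewrite trmx_mul map_mxM adjK.
Qed.

End haar.

Lemma eq_measure_full_set d (T : measurableType d) (R : realType)
    (mu : probability T R) (S A B : set T) :
  measurable S -> mu S = 1%E -> measurable A -> measurable B ->
  (forall x, S x -> A x <-> B x) -> mu A = mu B.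
Proof.
move=> mS muS mA mB AB.
have restrictS X : measurable X -> mu X = mu (X `&` S).
  move=> mX; apply: etrans (measureDI mu mX mS) _.
  rewrite -[RHS]add0e; congr (_ + _)%E.
  have muSC : mu (~` S) = 0%E by rewrite probability_setC// muS subee.
  apply: (subset_measure0 _ _ _ muSC); [exact: measurableD|exact: measurableC|].
  by move=> x [].
rewrite (restrictS _ mA) (restrictS _ mB); congr (mu _).
by apply/seteqP; split => x [ABx Sx]; split => //; exact/AB.
Qed.

(** * Closed unitary groups and stabilizers: measurability and inverses *)

Section unitary_subgroup.
Context (R : realType) (N : nat) (G : set 'M[R[i]]_N).
Local Notation "A ^t*" := (map_mx Num.conj A^T) : ring_scope.
Local Notation M := (borel 'M[R[i]]_N).
Hypothesis closedG : closed_unitary_subgroup G.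

Lemma closed_unitary_subgroup_measurable : measurable (G : set M).
Proof.
have [cG _ _ _ _] := closedG; rewrite -[X in measurable X](setCK G).
by apply: measurableC; apply: open_borel_measurable; exact: closed_openC.
Qed.

(** On unitary matrices the adjoint is the inverse. The Haar section uses the adjoint, whose
    measurability is immediate entrywise. *)
Lemma closed_unitary_subgroup_adj A : G A -> G (A ^t*).
Proof.
have [_ GU _ _ GV] := closedG; move=> GA; have /unitarymxP AA := GU _ GA.
suff -> : A ^t* = invmx A by exact: GV.
have [uA _] := mulmx1_unit AA.
by rewrite -[LHS]mul1mx -(mulVmx uA) -mulmxA AA mulmx1.
Qed.

Variable v : 'cV[R[i]]_N.

Lemma stabilizer_measurable : measurable (stabilizer G v : set M).
Proof.
apply: measurableI; first exact: closed_unitary_subgroup_measurable.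
apply: (@measurable_mx_eq _ _ M _ _ (mulmx^~ v) (cst v)).
  apply: mxmeasurableM; last exact: mxmeasurable_cst.
  exact: mxmeasurable_id.
exact: mxmeasurable_cst.
Qed.

Lemma stabilizer_adj A : stabilizer G v A -> stabilizer G v (A ^t*).
Proof.
move=> [GA Av]; split; first exact: closed_unitary_subgroup_adj.
have [_ GU _ _ _] := closedG; have /unitarymxP/mulmx1C AA := GU _ GA.
by rewrite -[in LHS]Av mulmxA AA mul1mx.
Qed.

End unitary_subgroup.

Theorem theorem1p2 (R : realType) (n : nat)
  (GG : set 'M[R[i]]_n.+1)
  (e : 'I_n.+1 -> 'cV[R[i]]_n.+1)
  (muG muH : probability (borel 'M[R[i]]_n.+1) R)
  (d : measure_display) (Omega : measurableType d) (P : probability Omega R)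
  (G G' : {RV P >-> borel 'M[R[i]]_n.+1})
  (H : {RV P >-> borel 'M[R[i]]_n}) :
  closed_unitary_subgroup GG ->
  orthonormal_basis e ->
  [set A *m e ord0 | A in GG] =
    [set M *m e ord0 | M in GG `&` [set M | hyperplane_reflection M]] ->
  haar_probability GG muG ->
  haar_probability (stabilizer GG (e ord0)) muH ->
  has_law G muG ->
  has_law G' muG ->
  has_law H (pushforward muH
    (restr_mx e : borel 'M[R[i]]_n.+1 -> borel 'M[R[i]]_n)) ->
  independent3 G G' H ->
  eq_in_law P
    (fun w => \det (1%:M - G w) : borel R[i])
    (fun w => (1 - hdot (e ord0) (G' w *m e ord0)) * \det (1%:M - H w)
              : borel R[i]).
Proof.
move=> closedG e_on orbitE haarG haarH lawG lawG' lawH indep B mB.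
have [_ GU _ GM _] := closedG.
pose S := stabilizer GG (e ord0).
have mG := closed_unitary_subgroup_measurable closedG.
have mS : measurable (S : set (borel _)) :=
  stabilizer_measurable closedG (e ord0).
have GV := closed_unitary_subgroup_adj closedG.
have SV := @stabilizer_adj _ _ _ closedG (e ord0).
have SU A : S A -> A \is unitarymx by move=> [/GU].
have mdet d' (Y : measurableType d') k (f : Y -> 'M[R[i]]_k) : mxmeasurable f ->
    cmeasurable (fun y => \det (1%:M - f y)).
  move=> mf; apply: cmeasurable_det.
  exact: (mxmeasurableB (mxmeasurable_cst Y 1%:M) mf).
have mpre d' (Y : measurableType d') (f : Y -> R[i]) : cmeasurable f ->
    measurable [set y | B (f y)].
  move=> mf; rewrite -[X in measurable X]setTI.
  exact: (measurable_fun_borelC mf).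
(* [A1] lives on pairs (group element, stabilizer element), [A2] on pairs of values of [G'] and [H];
   the proof goes from the law of [G] to [A1], then [A2], then the joint law of [G'] and [H]. *)
pose A1 : set (borel 'M[R[i]]_n.+1 * borel 'M[R[i]]_n.+1) :=
  [set z | B (\det (1%:M - z.1 *m z.2))].
pose A2 : set (borel 'M[R[i]]_n.+1 * borel 'M[R[i]]_n) :=
  [set z | B ((1 - hdot (e ord0) (z.1 *m e ord0)) * \det (1%:M - z.2))].
have mA1 : measurable A1.
  apply: mpre; apply: mdet; apply: mxmeasurableM.
    exact: (mxmeasurable_fun measurable_fst).
  exact: (mxmeasurable_fun measurable_snd).
have mA2 : measurable A2.
  apply: mpre; apply: cmeasurableM; last first.
    by apply: mdet; exact: (mxmeasurable_fun measurable_snd).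
  apply: cmeasurableD; first exact: cmeasurable_cst.
  apply: cmeasurableN; apply: cmeasurable_hdot; first exact: mxmeasurable_cst.
  apply: mxmeasurableM; last exact: mxmeasurable_cst.
  exact: (mxmeasurable_fun measurable_fst).
have mB1 : measurable ([set g | B (\det (1%:M - g))] :
    set (borel 'M[R[i]]_n.+1)).
  by apply/mpre/mdet; exact: mxmeasurable_id.
have mrestr : mxmeasurable (restr_mx e : borel 'M[R[i]]_n.+1 -> 'M[R[i]]_n).
  move=> i j; under eq_fun do rewrite mxE.
  apply: cmeasurable_hdot; first exact: mxmeasurable_cst.
  by apply: mxmeasurableM; [exact: mxmeasurable_id|exact: mxmeasurable_cst].
transitivity (muG [set g | B (\det (1%:M - g))]).
  exact: (lawG _ mB1).
transitivity ((muG \x muH)%E A1).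
  apply/esym/(product_measure_ysection_cst mA1 mS haarH.1) => h [Gh _].
  rewrite -(haar_preimage_mulr mG GU GV haarG Gh mB1); congr (muG _).
  by apply/seteqP; split => g; rewrite /A1 /ysection /= in_setE.
transitivity ((muG \x distribution P H)%E A2).
  apply: (eq_product_measure_xsection mA1 mA2 mG haarG.1) => g Gg.
  have [M [GM' reflM] Me] : [set M *m e ord0 |
      M in GG `&` [set M | hyperplane_reflection M]] (g *m e ord0).
    by rewrite -orbitE; exists g.
  (* As [g] and [M] agree on [e ord0], the inverse of [M] times [g] fixes it. *)
  pose h0 := map_mx Num.conj M^T *m g.
  have MU := GU _ GM'; have /unitarymxP MM := MU.
  have Sh0 : S h0.
    split; first exact: GM (GV _ GM') Gg.
    by rewrite -mulmxA -Me mulmxA (mulmx1C MM) mul1mx.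
  have Mh0 : M *m h0 = g by rewrite mulmxA MM mul1mx.
  have mBM : measurable ([set h | B (\det (1%:M - M *m h))] :
      set (borel 'M[R[i]]_n.+1)).
    apply: mpre; apply: mdet.
    exact: (mxmeasurableM (mxmeasurable_cst _ M) (@mxmeasurable_id _ _ _)).
  apply: etrans (esym (lawH _ (measurable_xsection _ mA2))).
  transitivity (muH [set h | B (\det (1%:M - M *m h))]).
    rewrite -(haar_preimage_mull SU SV haarH Sh0 mBM); congr (muH _).
    by apply/seteqP; split => h; rewrite /A1 /xsection /= in_setE /= mulmxA Mh0.
  (* The determinant identity holds for [h] in the stabilizer, which has full [muH] measure; the two
     events may differ elsewhere. *)
  apply: (eq_measure_full_set mS haarH.1) => //.
    rewrite -[X in measurable X]setTI; apply: (measurable_fun_mx mrestr) => //.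
    exact: measurable_xsection.
  move=> h [Gh he]; rewrite /A2 /xsection /= in_setE /=.
  by rewrite -Me (det_reflection_stabilizer e_on reflM _ he)//; exact: GU.
(* It remains to see that the joint law of [G'] and [H] is the product measure, which is checked on
   rectangles. *)
have mpair : measurable_fun setT (fun w => (G' w, H w)).
  by apply: measurable_fun_pair.
pose GH : {RV P >-> (borel 'M[R[i]]_n.+1 * borel 'M[R[i]]_n)%type} :=
  mfun_Sub (mem_set mpair).
apply: (product_measure_unique (m' := distribution P GH)) => // C D mC mD.
transitivity (P (G' @^-1` C) * P (H @^-1` D))%E; last first.
  by congr (_ * _)%E; exact: lawG'.
(* Taking the whole space for [G] extracts the independence of [G'] and [H]. *)
have := indep setT C D measurableT mC mD.
by rewrite preimage_setT setTI probability_setT mul1e.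
Qed.
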